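(* Let $M\ge 2$, $Q\ge 1$ and $n$ be integers, and consider the hypergraph stochastic blockmodel (HSBM) with $Q$ groups for simple hypergraphs over $n$ nodes with hyperedges of sizes $2,\dots,M$, with parameter $\theta=\big((\pi_q)_{1\le q\le Q},(B^{(m)}_{q_1,\dots,q_m})_{2\le m\le M,\ 1\le q_1\le\dots\le q_m\le Q}\big)\in\Theta$. If $$n\ \ge\ Q^2\big(M!\,QM+M-1\big)^{2/(M-1)},$$ then $\theta$ is generically identifiable up to label switching on the node groups: there is a subset $\mathcal N\subset\Theta$ of dimension strictly smaller than that of $\Theta$ such that for every $\theta\in\Theta\setminus\mathcal N$ and every $\theta'\in\Theta$, if $\mathbb P_{\theta'}=\mathbb P_\theta$ (as distributions of the random hypergraph over the $n$ nodes) then $\theta'$ is obtained from $\theta$ by a permutation of the group labels $\{1,\dots,Q\}$.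
   Context: Nodes are $\mathcal V=\{1,\dots,n\}$. A simple hypergraph on $\mathcal V$ with hyperedge sizes at most $M$ is a set of subsets (hyperedges) of $\mathcal V$ of cardinality between $2$ and $M$; it is encoded by indicators $Y_{i_1,\dots,i_m}\in\{0,1\}$, one for each $m$-subset $\{i_1,\dots,i_m\}$ of $\mathcal V$, $2\le m\le M$. HSBM: latent variables $Z_1,\dots,Z_n$ are i.i.d. with values in $\{1,\dots,Q\}$ and $\mathbb P(Z_i=q)=\pi_q$, where $\pi_q\ge 0$ and $\sum_q\pi_q=1$. Conditionally on $(Z_1,\dots,Z_n)$, all the indicators $Y_{i_1,\dots,i_m}$ (over all $m$-subsets and all $2\le m\le M$) are independent, and $Y_{i_1,\dots,i_m}$ is Bernoulli with parameter $B^{(m)}_{Z_{i_1},\dots,Z_{i_m}}$, where for each $m$ the tensor $B^{(m)}$ has entries in $[0,1]$ and is fully symmetric: $B^{(m)}_{q_1,\dots,q_m}=B^{(m)}_{q_{\sigma(1)},\dots,q_{\sigma(m)}}$ for every permutation $\sigma$ of $\{1,\dots,m\}$. $\mathbb P_\theta$ denotes the resulting (marginal) distribution of all the indicators; the $Z_i$ are not observed. $\Theta$ is the set of all such $\theta$, i.e. the product of the probability simplex on $Q$ points and $\prod_{m=2}^M[0,1]^{\binom{Q+m-1}{m}}$. A permutation $s$ of $\{1,\dots,Q\}$ acts on parameters by $\pi'_q=\pi_{s(q)}$, $B'^{(m)}_{q_1,\dots,q_m}=B^{(m)}_{s(q_1),\dots,s(q_m)}$ for all $m$ simultaneously (label switching).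 A subset of dimension strictly smaller than the full parameter space has, in particular, Lebesgue measure zero in it. *)

(* Defs.v *)
From HB Require Import structures.
From mathcomp Require Import all_boot all_order perm all_algebra.
(* The notations of mpoly clash with those of mathcomp-analysis. *)
From mathcomp Require Import -(notations) mpoly.
From mathcomp Require Import boolp classical_sets reals exp.
From mathcomp Require Import bernoulli_distribution.

Set Implicit Arguments.
Unset Strict Implicit.
Unset Printing Implicit Defensive.

Import Order.TTheory GRing.Theory Num.Theory.
Local Open Scope ring_scope.

(** * Dimension of a subset of R^I *)

Section Dimension.
Variables (R : realType) (I : finType).

(* No nonzero polynomial in the coordinates of J vanishes on S, i.e. the
   projection of S to R^J is Zariski dense. *)
Definition alg_independent (S : set (I -> R)) (J : {set I}) : Prop :=
  forall p : mpoly #|J| R,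
    (forall x, S x -> meval (fun j => x (enum_val j)) p = 0) -> p = 0.

(* The dimension of S in the sense of real algebraic geometry: the Krull
   dimension of R[X_i, i in I] / I(S), where I(S) is the ideal of the polynomials
   vanishing on S, that is, the dimension of the Zariski closure of S. It is
   computed as the largest number of coordinates that are algebraically
   independent modulo I(S). On nonempty semialgebraic sets it agrees with the
   topological and Hausdorff dimensions; in general it is at least as large as
   these. The empty set gets dimension 0. *)
Definition zariski_dim (S : set (I -> R)) : nat :=
  \max_(J : {set I} | `[< alg_independent S J >]) #|J|.

End Dimension.

(** * Parameters *)

(* The tuples q_1 <= ... <= q_m of groups with 2 <= m <= M; m is the size. *)
Definition ord_leq Q : rel 'I_Q := fun q r => (q <= r)%N.

Definition multi_index (Q M : nat) : finType :=
  {s : M.-bseq 'I_Q | (1 < size s)%N && sorted (@ord_leq Q) s}.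

Definition param_index (Q M : nat) : finType := ('I_Q + multi_index Q M)%type.

Definition param (R : realType) (Q M : nat) := param_index Q M -> R.

Lemma sort_index_size Q M m (hm : (1 < m <= M)%N) (q : m.-tuple 'I_Q) :
  (size (sort (@ord_leq Q) q) <= M)%N.
Proof. by rewrite size_sort size_tuple; case/andP: hm. Qed.

Lemma sort_index_subproof Q M m (hm : (1 < m <= M)%N) (q : m.-tuple 'I_Q) :
  let s := Bseq (sort_index_size hm q) in
  (1 < size s)%N && sorted (@ord_leq Q) s.
Proof.
rewrite /= size_sort size_tuple; case/andP: hm => -> _ /=.
by apply: sort_sorted => x y; exact: leq_total.
Qed.

Definition sort_index Q M m (hm : (1 < m <= M)%N) (q : m.-tuple 'I_Q) :
  multi_index Q M := Sub (Bseq (sort_index_size hm q)) (sort_index_subproof hm q).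

Section Model.
Variables (R : realType) (Q M : nat).
Implicit Types theta : param R Q M.

Definition prior theta (q : 'I_Q) : R := theta (inl q).

(* The entry B^(m)_(q_1, ..., q_m), for q_1, ..., q_m in any order. *)
Definition tensor theta m (hm : (1 < m <= M)%N) (q : m.-tuple 'I_Q) : R :=
  theta (inr (sort_index hm q)).

Lemma tensor_sym theta m (hm : (1 < m <= M)%N) (q r : m.-tuple 'I_Q) :
  perm_eq q r -> tensor theta hm q = tensor theta hm r.
Proof.
move=> qr; congr (theta (inr _)); apply/val_inj/val_inj => /=.
by apply/perm_sortP => //;
  [move=> x y; exact: leq_total | move=> x y z; exact: leq_trans
  | move=> x y /anti_leq/val_inj].
Qed.

Definition Theta : set (param R Q M) := [set theta |
  [/\ forall q, 0 <= prior theta q,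
      \sum_(q < Q) prior theta q = 1 &
      forall k : multi_index Q M, 0 <= theta (inr k) <= 1]].

Definition label_switching (s : {perm 'I_Q}) theta theta' : Prop :=
  (forall q, prior theta' q = prior theta (s q)) /\
  (forall m (hm : (1 < m <= M)%N) (q : m.-tuple 'I_Q),
     tensor theta' hm q = tensor theta hm (map_tuple s q)).

(** * Distribution of the hypergraph *)

Variable n : nat.

Definition hyperedge : finType := {e : {set 'I_n} | (1 < #|e| <= M)%N}.

(* A simple hypergraph, encoded by its indicators Y_e. *)
Definition hypergraph : finType := {ffun hyperedge -> bool}.

(* By symmetry of the tensor, the order in which the nodes of e are listed is
   immaterial. *)
Definition hyperedge_prob theta (z : {ffun 'I_n -> 'I_Q}) (e : hyperedge) : R :=
  tensor theta (valP e) (map_tuple z (enum_tuple (val e))).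

(* Probability mass of the joint law of (Z, Y), at (z, y). *)
Definition joint_law theta (z : {ffun 'I_n -> 'I_Q}) (y : hypergraph) : R :=
  (\prod_(i < n) prior theta (z i)) *
  \prod_(e : hyperedge) bernoulli_pmf (hyperedge_prob theta z e) (y e).

(* The distribution P_theta of Y, given by its probability mass function. *)
Definition hsbm_law theta (y : hypergraph) : R :=
  \sum_(z : {ffun 'I_n -> 'I_Q}) joint_law theta z y.

End Model.

(* Main.v *)
(* Pendant edges make the degrees visible: if [d_q] is the mean edge density
   [\sum_r pi_r B^(2)_(q, r)] of a node of group [q], a given node carries [k]
   given edges with probability [\sum_q pi_q d_q ^ k]. For [k < 2 Q] these moments
   determine the measure [\sum_q pi_q \delta_(d_q)] among the measures with at
   most [Q] atoms, hence [pi] and [d] up to a permutation, as soon as the [d_q]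
   are distinct and the [pi_q] nonzero. Planting a hyperedge of size [m] on nodes
   that carry [k_1, ..., k_m < Q] pendant edges (at most [M * Q] nodes in all)
   gives the mixed moments [\sum_w (\prod_i pi_(w_i) d_(w_i) ^ k_i) B^(m)_w], from
   which [B^(m)] is read off by Lagrange interpolation at the [d_q]. The
   exceptional set is cut out of the hyperplane [\sum_q pi_q = 1] by one
   polynomial that does not vanish on it. *)

Require Import Defs.
From mathcomp Require Import all_boot all_order perm all_algebra.
From mathcomp Require Import -(notations) mpoly.
From mathcomp Require Import boolp classical_sets reals exp.
From mathcomp Require Import bernoulli_distribution.

Set Implicit Arguments.
Unset Strict Implicit.
Unset Printing Implicit Defensive.

Import Order.TTheory GRing.Theory Num.Theory.
Local Open Scope ring_scope.

(** * Zariski density and dimension *)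

(** Reduction mod [N] isolates the lowest digit; division by [N] shifts the others down. *)
Lemma radix_inj N n (a b : nat -> nat) :
  (forall i, a i < N)%N -> (forall i, b i < N)%N ->
  (\sum_(i < n) a i * N ^ i = \sum_(i < n) b i * N ^ i)%N ->
  forall i, (i < n)%N -> a i = b i.
Proof.
move=> aN bN; elim: n a b aN bN => [|n IHn] a b aN bN //.
have split_sum (c : nat -> nat) : (\sum_(i < n.+1) c i * N ^ i =
    (\sum_(i < n) c i.+1 * N ^ i) * N + c 0)%N.
  rewrite big_ord_recl muln1 addnC big_distrl /=; congr (_ + _)%N.
  by apply: eq_bigr => i _; rewrite /bump leq0n expnSr mulnA.
rewrite !split_sum => eq_ab [_|i lt_in].
  by move: (congr1 (modn^~ N) eq_ab); rewrite !modnMDl !modn_small.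
apply: (IHn (a \o succn) (b \o succn)) => [j|j||//]; [exact: aN|exact: bN|].
have N0 : (0 < N)%N by exact: leq_ltn_trans (aN 0).
move: (congr1 (divn^~ N) eq_ab).
by rewrite /= !divnMDl // !(divn_small (aN 0)) !(divn_small (bN 0)) !addn0.
Qed.

Lemma poly_eq0_small (R : realFieldType) (p : {poly R}) (e : R) : 0 < e ->
  (forall t, 0 < t <= e -> p.[t] = 0) -> p = 0.
Proof.
(* These are [size p] distinct roots, one too many for a nonzero [p]. *)
move=> e0 p0; pose rs := [seq e / k.+1%:R | k <- iota 0 (size p)].
apply: (@roots_geq_poly_eq0 _ p rs); last by rewrite size_map size_iota.
  apply/allP => _ /mapP[k _ ->]; apply/eqP/p0.
  rewrite divr_gt0 ?ltr0Sn //= ler_pdivrMr ?ltr0Sn // ler_peMr ?ler1n //.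
  exact: ltW.
rewrite map_inj_uniq ?iota_uniq // => k l /(mulfI (lt0r_neq0 e0)) /invr_inj.
by move/eqP; rewrite eqr_nat => /eqP[].
Qed.

(* Kronecker substitution: [X_i := t ^ (N ^ i)] with [N] above the degree maps
   distinct monomials to distinct powers of [t]. *)
Lemma mpoly_eq0_small (R : realFieldType) n (p : mpoly n R) (e : R) :
  0 < e <= 1 -> (forall v, (forall i, 0 <= v i <= e) -> meval v p = 0) -> p = 0.
Proof.
move=> /andP[e0 e1] p0.
pose N := (msize p).+1; pose kr (m : multinom n) := (\sum_(i < n) m i * N ^ i)%N.
have kr_inj : {in msupp p &, injective kr}.
  move=> m1 m2 m1p m2p eq_kr; apply/mnmP => i.
  (* [radix_inj] takes digits indexed by [nat], so the exponents are padded with 0. *)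
  pose ext (m : multinom n) j := if insub j is Some i then m i else 0%N.
  have extE m (j : 'I_n) : ext m j = m j by rewrite /ext valK.
  have ext_lt m : m \in msupp p -> forall j, (ext m j < N)%N.
    move=> mp j; rewrite /ext; case: insubP => [k _ _|_] //.
    rewrite /N ltnS (leq_trans _ (ltnW (msize_mdeg_lt mp))) //.
    by rewrite mdegE (bigD1 k) //= leq_addr.
  rewrite -!extE; apply: (radix_inj (ext_lt _ m1p) (ext_lt _ m2p)) (ltn_ord i).
  by under eq_bigr do rewrite extE; under [RHS]eq_bigr do rewrite extE.
pose P : {poly R} := \sum_(m <- msupp p) (mcoeff m p) *: 'X^(kr m).
have P0 : P = 0.
  apply: (poly_eq0_small e0) => t /andP[t0 te].
  rewrite -(p0 (fun i => t ^+ (N ^ i))) => [|i].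
    rewrite mevalE /P horner_sum; apply: eq_bigr => m _.
    rewrite hornerZ hornerXn; congr (_ * _).
    rewrite /kr -prodrXr.
    by apply: eq_bigr => i _; rewrite -exprM mulnC.
  (* [t <= e <= 1] and [N ^ i >= 1] keep the substituted point in the cube. *)
  apply/andP; split; first exact/exprn_ge0/ltW.
  apply: le_trans (te); rewrite -[leRHS]expr1.
  by rewrite ler_wiXn2l ?expn_gt0 ?(ltW t0) ?(le_trans te).
apply/eqP; rewrite -msupp_eq0; case E : (msupp p) => [|m s] //.
have mp : m \in msupp p by rewrite E mem_head.
move: (mp); rewrite mcoeff_msupp => /negP[]; apply/eqP.
have := congr1 (fun q : {poly R} => q`_(kr m)) P0.
rewrite coef0 /P coef_sum (bigD1_seq m) ?msupp_uniq //=.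
rewrite coefZ coefXn eqxx mulr1 big1_seq ?addr0 // => m' /andP[m'm m'p].
rewrite coefZ coefXn [_ == _](contra_neqF _ m'm) ?mulr0 // => /eqP.
by move/kr_inj => ->.
Qed.

(** * Functions polynomial in selected coordinates *)

Section CoordinatePolynomials.
Variables (R : realType) (I : finType) (J : {set I}).
Implicit Types F G : (I -> R) -> R.

Definition coord_poly F := exists p : mpoly #|J| R,
  forall x, F x = meval (fun j => x (enum_val j)) p.

Lemma coord_poly_const c : coord_poly (fun=> c).
Proof. by exists (mpolyC _ c) => x; rewrite mevalC. Qed.

Lemma coord_poly_var i : i \in J -> coord_poly (fun x => x i).
Proof.
move=> iJ; exists (mpolyX R (mnm1 (enum_rank_in iJ i))) => x.
by rewrite mevalXU enum_rankK_in.
Qed.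

Lemma coord_polyD F G :
  coord_poly F -> coord_poly G -> coord_poly (fun x => F x + G x).
Proof.
by move=> [p pF] [q qG]; exists (p + q) => x; rewrite mevalD pF qG.
Qed.

Lemma coord_polyM F G :
  coord_poly F -> coord_poly G -> coord_poly (fun x => F x * G x).
Proof.
by move=> [p pF] [q qG]; exists (p * q) => x; rewrite mevalM pF qG.
Qed.

Lemma coord_polyB F G :
  coord_poly F -> coord_poly G -> coord_poly (fun x => F x - G x).
Proof.
by move=> [p pF] [q qG]; exists (p - q) => x; rewrite mevalB pF qG.
Qed.

Lemma coord_poly_sum (K : finType) (P : pred K) (F : K -> (I -> R) -> R) :
  (forall k, P k -> coord_poly (F k)) ->
  coord_poly (fun x => \sum_(k | P k) F k x).
Proof.
move=> polyF; have polyF' k : exists p : mpoly #|J| R, P k ->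
    forall x, F k x = meval (fun j => x (enum_val j)) p.
  by case Pk: (P k); [have [p] := polyF k Pk; exists p | exists 0].
have [p pF] := choice polyF'; exists (\sum_(k | P k) p k) => x.
by rewrite raddf_sum; apply: eq_bigr => k /pF ->.
Qed.

Lemma coord_poly_prod (K : finType) (P : pred K) (F : K -> (I -> R) -> R) :
  (forall k, P k -> coord_poly (F k)) ->
  coord_poly (fun x => \prod_(k | P k) F k x).
Proof.
move=> polyF; have polyF' k : exists p : mpoly #|J| R, P k ->
    forall x, F k x = meval (fun j => x (enum_val j)) p.
  by case Pk: (P k); [have [p] := polyF k Pk; exists p | exists 0].
have [p pF] := choice polyF'; exists (\prod_(k | P k) p k) => x.
by rewrite rmorph_prod; apply: eq_bigr => k /pF ->.
Qed.

(** A single point where [F] is nonzero, even outside [S], thus refutes the independence of [J]. *)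
Lemma coord_poly_eq0 S F : alg_independent S J -> coord_poly F ->
  (forall x, S x -> F x = 0) -> forall x, F x = 0.
Proof.
move=> indepJ [p pF] F0 x; rewrite pF (indepJ p) ?meval0 // => y Sy.
by rewrite -pF F0.
Qed.

End CoordinatePolynomials.

(** * Dimensions of the parameter space and of the exceptional set *)

Section ParameterDimension.
Variables (R : realType) (Q M : nat) (hM : (1 < 2 <= M)%N).
Implicit Types theta : param R Q M.

Definition mean_degree theta (q : 'I_Q) : R :=
  \sum_(r < Q) prior theta r * tensor theta hM [tuple q; r].

(** Nonzero exactly when no prior vanishes and the mean degrees are distinct. The second product is,
    up to sign, the discriminant of the polynomial with the mean degrees as roots. *)
Definition discriminant theta : R :=
  (\prod_(q < Q) prior theta q) *
  \prod_(q < Q) \prod_(r < Q | r != q) (mean_degree theta q - mean_degree theta r).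

Definition degenerate : set (param R Q M) :=
  [set theta | Theta theta /\ discriminant theta = 0]%classic.

(** The coordinates other than [inl q0] can fill a small cube, the prior of [q0] being adjusted to
    make the sum 1. *)
Lemma Theta_dim_ge (q0 : 'I_Q) :
  (#|param_index Q M|.-1 <= zariski_dim (@Theta R Q M))%N.
Proof.
pose J : {set param_index Q M} := [set~ inl q0].
rewrite -(_ : #|J| = #|param_index Q M|.-1)%N; last first.
  by rewrite /J cardsC1.
apply: (leq_bigmax_cond (F := fun J : {set param_index Q M} => #|J|)).
apply/asboolP => p p0.
have Q0 : (0 < Q)%N by exact: leq_ltn_trans (leq0n _) (ltn_ord q0).
(* With side [1 / Q] the other [Q - 1] priors sum to at most 1, so the prior of [q0] is
   nonnegative. *)
have Q1 : 0 < (Q%:R^-1 : R) <= 1.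
  by rewrite invr_gt0 ltr0n Q0 invf_le1 ?ltr0n // ler1n.
apply: (mpoly_eq0_small Q1) => v v_small.
pose y (i : param_index Q M) : R :=
  if [pick j | enum_val j == i] is Some j then v j else 0.
have yE j : y (enum_val j) = v j.
  rewrite /y; case: pickP => [k /eqP/enum_val_inj -> //|/(_ j)].
  by rewrite eqxx.
have y_small i : 0 <= y i <= Q%:R^-1.
  by rewrite /y; case: pickP => [j _|_] //; rewrite lexx ltW //; case/andP: Q1.
pose x (i : param_index Q M) : R :=
  if i == inl q0 then 1 - \sum_(q < Q | q != q0) y (inl q) else y i.
rewrite -(p0 x) => [|].
  apply: meval_eq => j; rewrite /x -yE ifF //; apply/negbTE.
  by have := enum_valP j; rewrite !inE.
have xl q : q != q0 -> x (inl q) = y (inl q).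
  by move=> qq0; rewrite /x ifF //; apply/negbTE.
split=> [q||k].
- rewrite /prior /x; case: eqP => _; last by case/andP: (y_small (inl q)).
  rewrite subr_ge0; apply: (@le_trans _ _ (\sum_(q < Q | q != q0) Q%:R^-1)).
    by apply: ler_sum => r _; case/andP: (y_small (inl r)).
  rewrite sumr_const -[leLHS]mulr_natl ler_pdivrMr ?ltr0n // mul1r ler_nat.
  by rewrite (leq_trans (max_card _)) // card_ord.
- rewrite /prior (bigD1 q0) //= (eq_bigr (fun q => y (inl q))) //.
  by rewrite /x eqxx subrK.
- rewrite /x /=; have /andP[-> yQ] := y_small (inr k).
  by rewrite (le_trans yQ) //; case/andP: Q1.
Qed.

(** Ensures that the truncated [.-2] in the bound on [degenerate] is strictly below [.-1]. *)
Lemma card_param_index (q0 : 'I_Q) : (1 < #|param_index Q M|)%N.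
Proof.
rewrite card_sum card_ord -[2%N]/(1 + 1)%N leq_add //.
  exact: leq_ltn_trans (leq0n _) (ltn_ord q0).
by apply/card_gt0P; exists (sort_index hM [tuple q0; q0]).
Qed.

Lemma sort_index_pair_eq (q r s : 'I_Q) :
  (sort_index hM [tuple q; r] == sort_index hM [tuple s; s]) = (q == s) && (r == s).
Proof.
apply/eqP/andP => [/(congr1 (val \o val))/= eq_sort|[/eqP -> /eqP ->] //].
have mem_s u : u \in sort (@ord_leq Q) [:: q; r] -> u == s.
  by rewrite eq_sort mem_sort !inE orbb.
by split; apply: mem_s; rewrite mem_sort !inE eqxx ?orbT.
Qed.

(** An independent [J] cannot omit at most one coordinate. If it contains all priors, their sum
    minus 1 is a nonzero polynomial vanishing on [degenerate]; otherwise it omits just one prior,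
    and eliminating that prior from the discriminant gives such a polynomial. *)
Lemma degenerate_dim_le (q0 : 'I_Q) :
  (zariski_dim degenerate <= #|param_index Q M|.-2)%N.
Proof.
apply/bigmax_leqP => J /asboolP indepJ; rewrite leqNgt; apply/negP => J_large.
have sum_eq1 theta : degenerate theta -> \sum_q prior theta q = 1 by case=> -[].
have [/forallP priorJ|/forallPn[{}q0 q0J]] := boolP [forall q : 'I_Q, inl q \in J].
  have polyF : coord_poly J (fun x : param R Q M => \sum_q prior x q - 1).
    apply: coord_polyB (coord_poly_const _ _); apply: coord_poly_sum => q _.
    exact: coord_poly_var.
  have sum0 theta : degenerate theta -> \sum_q prior theta q - 1 = 0.
    by move=> /sum_eq1 ->; rewrite subrr.
  have /eqP := coord_poly_eq0 indepJ polyF sum0 (fun=> 0).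
  by rewrite big1 // sub0r oppr_eq0 oner_eq0.
have memJ i : i != inl q0 -> i \in J.
  move=> iq0; apply: contraLR J_large => iJ; rewrite -leqNgt.
  have : J \subset ~: [set i; inl q0].
    apply/fintype.subsetP => j jJ; rewrite !inE negb_or.
    by apply/andP; split; apply: contraTneq jJ => ->.
  move=> /subset_leq_card /leq_trans; apply.
  by rewrite cardsCs finset.setCK cards2 iq0 subn2.
pose normalize (x : param R Q M) : param R Q M := fun i =>
  if i == inl q0 then 1 - \sum_(q < Q | q != q0) x (inl q) else x i.
have poly_norm i : coord_poly J (fun x => normalize x i).
  rewrite /normalize; case: eqP => [_|/eqP i_q0]; last exact/coord_poly_var/memJ.
  apply: coord_polyB (coord_poly_const _ _) _; apply: coord_poly_sum => q qq0.
  by apply/coord_poly_var/memJ/eqP => -[/eqP]; apply/negP.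
have normK theta : degenerate theta -> normalize theta = theta.
  move=> /sum_eq1; rewrite (bigD1 q0) //= => sum1; apply/funext => i.
  rewrite /normalize; case: eqP => // ->.
  by rewrite -sum1 /prior addrK.
have poly_degree q : coord_poly J (fun x => mean_degree (normalize x) q).
  by apply: coord_poly_sum => r _; apply: coord_polyM; exact: poly_norm.
have polyF : coord_poly J (fun x => discriminant (normalize x)).
  apply: coord_polyM; first by apply: coord_poly_prod => q _; exact: poly_norm.
  by do 2!apply: coord_poly_prod => ? _; exact: coord_polyB.
have Q0 : Q%:R != 0 :> R.
  by rewrite pnatr_eq0 -lt0n; exact: leq_ltn_trans (leq0n _) (ltn_ord q0).
(* Uniform priors and a diagonal edge matrix with entries [q] give the distinct mean degrees
   [q / Q]. Entries above 1 are harmless: the polynomial would vanish outside [Theta] too. *)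
pose diag (k : multi_index Q M) : R :=
  \sum_(q < Q) (k == sort_index hM [tuple q; q])%:R * q%:R.
pose x0 : param R Q M := fun i =>
  match i with inl _ => Q%:R^-1 | inr k => diag k end.
have x0_norm : normalize x0 = x0.
  apply/funext => i; rewrite /normalize; case: eqP => // -> /=.
  have : \sum_(q < Q) (Q%:R^-1 : R) = 1.
    by rewrite sumr_const card_ord -[LHS]mulr_natr mulVf.
  by rewrite (bigD1 q0) //= => sum1; rewrite -[X in X - _]sum1 addrK.
have x0_tensor q r : tensor x0 hM [tuple q; r] = (q == r)%:R * q%:R.
  rewrite /tensor /= /diag; under eq_bigr do rewrite sort_index_pair_eq.
  rewrite (bigD1 q) //= eqxx eq_sym big1 ?addr0 // => s sq.
  by rewrite eq_sym (negbTE sq) mul0r.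
have x0_degree q : mean_degree x0 q = q%:R / Q%:R.
  rewrite /mean_degree (bigD1 q) //= x0_tensor eqxx mul1r mulrC big1 ?addr0 //.
  by move=> r rq; rewrite x0_tensor eq_sym (negbTE rq) mul0r mulr0.
have F0 theta : degenerate theta -> discriminant (normalize theta) = 0.
  by move=> Dtheta; rewrite normK //; case: Dtheta.
have /eqP := coord_poly_eq0 indepJ polyF F0 x0.
rewrite x0_norm mulf_eq0 => /orP[/prodf_eq0[q _]|/prodf_eq0[q _ /prodf_eq0[r rq]]].
  by rewrite invr_eq0 (negbTE Q0).
rewrite !x0_degree subr_eq0 => /eqP/(divIf Q0)/eqP.
by rewrite eqr_nat => /eqP/val_inj qr; rewrite qr eqxx in rq.
Qed.

Lemma degenerate_dim_lt (q0 : 'I_Q) :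
  (zariski_dim degenerate < zariski_dim (@Theta R Q M))%N.
Proof.
apply: leq_trans (Theta_dim_ge q0); apply: leq_ltn_trans (degenerate_dim_le q0) _.
by case: #|_| (card_param_index q0) => [|[]].
Qed.

End ParameterDimension.

(** * Recovering a measure and a tensor from moments *)

Section VandermondeIdentification.
Variables (R : fieldType) (Q : nat).
Implicit Types d p : 'I_Q -> R.

(** The Lagrange basis polynomial at [d q], without its normalization. *)
Definition node_poly d (q : 'I_Q) : {poly R} :=
  \prod_(r < Q | r != q) ('X - (d r)%:P).

Lemma size_node_poly d q : size (node_poly d q) = Q.
Proof.
rewrite /node_poly -big_filter size_prod_XsubC.
have [e _ _ [_ ->]] := big_enumP; rewrite cardC1 card_ord prednK //.
exact: leq_ltn_trans (leq0n _) (ltn_ord q).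
Qed.

Lemma node_poly_root d q r : r != q -> (node_poly d q).[d r] = 0.
Proof.
by move=> rq; rewrite horner_prod (bigD1 r) //= hornerXsubC subrr mul0r.
Qed.

Lemma node_poly_neq0 d q : injective d -> (node_poly d q).[d q] != 0.
Proof.
move=> d_inj; rewrite horner_prod; apply/prodf_neq0 => r rq.
by rewrite hornerXsubC subr_eq0 (inj_eq d_inj) eq_sym.
Qed.

Lemma moments_poly d d' p p' N (f : {poly R}) : (size f <= N)%N ->
  (forall k, (k < N)%N ->
     \sum_q p' q * d' q ^+ k = \sum_q p q * d q ^+ k) ->
  \sum_q p' q * f.[d' q] = \sum_q p q * f.[d q].
Proof.
move=> f_small moments; have expand a b : \sum_q a q * f.[b q] =
    \sum_(k < N) f`_k * \sum_q a q * b q ^+ k.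
  under eq_bigr => q _ do rewrite (horner_coef_wide _ f_small) mulr_sumr.
  rewrite exchange_big /=; apply: eq_bigr => k _; rewrite mulr_sumr.
  by apply: eq_bigr => q _; rewrite mulrCA.
by rewrite !expand; apply: eq_bigr => k _; rewrite moments.
Qed.

(** If no [d' r] equalled [d q], a polynomial vanishing at all [d' r] and at every [d r] but [d q]
    would separate the two sums. The matching of atoms so obtained is injective because [d] is, and
    testing against [node_poly d q] compares the weights. *)
Lemma moments_identify d d' p p' : injective d -> (forall q, p q != 0) ->
  (forall k, (k < Q + Q)%N ->
     \sum_q p' q * d' q ^+ k = \sum_q p q * d q ^+ k) ->
  exists s : {perm 'I_Q}, forall q, d' (s q) = d q /\ p' (s q) = p q.
Proof.
move=> d_inj p0 moments.
have atom q : exists r, d' r == d q.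
  apply/existsP; apply: contraT => /existsPn d'q.
  pose g := \prod_(r < Q) ('X - (d' r)%:P); pose f := node_poly d q * g.
  have g0 x : (g.[x] == 0) = [exists r, d' r == x].
    rewrite horner_prod; apply/prodf_eq0/existsP => -[r]; exists r => //.
      by rewrite eq_sym -subr_eq0 -hornerXsubC.
    by rewrite hornerXsubC subr_eq0 eq_sym.
  (* [Q - 1] roots among the [d r] and [Q] among the [d' r] give degree [2 Q - 1], the highest
     moment available. *)
  have f_small : (size f <= Q + Q)%N.
    rewrite (leq_trans (size_polyMleq _ _)) // size_node_poly.
    by rewrite size_prod_XsubC /= -sum1_size big_const_ord iter_addn_0 mul1n addnS.
  have := moments_poly f_small moments.
  rewrite big1 => [|r _]; last first.
    rewrite hornerM (eqP (_ : g.[d' r] == 0)) ?mulr0 // g0.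
    by apply/existsP; exists r.
  rewrite (bigD1 q) //= big1 => [|r rq]; last first.
    by rewrite hornerM node_poly_root // mul0r mulr0.
  move/esym/eqP; rewrite addr0 mulf_eq0 (negbTE (p0 q)) hornerM mulf_eq0.
  rewrite (negbTE (node_poly_neq0 q d_inj)) /= g0 => /existsP[r].
  by rewrite (negbTE (d'q r)).
have [s0 s0E] := fin_all_exists atom.
have s0_inj : injective s0.
  by move=> q r eq_s; apply: d_inj; rewrite -(eqP (s0E q)) eq_s (eqP (s0E r)).
exists (perm s0_inj) => q; rewrite permE; split; first exact/eqP.
have f_small : (size (node_poly d q) <= Q + Q)%N.
  by rewrite size_node_poly leq_addr.
have := moments_poly f_small moments.
rewrite (reindex_inj s0_inj) /= (bigD1 q) //= big1 => [|r rq]; last first.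
  by rewrite (eqP (s0E r)) node_poly_root // mulr0.
rewrite [RHS](bigD1 q) //= big1 => [|r rq]; last first.
  by rewrite node_poly_root // mulr0.
rewrite !addr0 (eqP (s0E q)) => /mulIf; apply.
exact: node_poly_neq0.
Qed.

Lemma joint_moments_poly m d p (B : {ffun 'I_m -> 'I_Q} -> R)
    (f : 'I_m -> {poly R}) : (forall i, size (f i) <= Q)%N ->
  \sum_(w : {ffun 'I_m -> 'I_Q}) (\prod_i (p (w i) * (f i).[d (w i)])) * B w =
  \sum_(k : {ffun 'I_m -> 'I_Q}) (\prod_i (f i)`_(k i)) *
    \sum_(w : {ffun 'I_m -> 'I_Q}) (\prod_i (p (w i) * d (w i) ^+ k i)) * B w.
Proof.
move=> f_small; under [RHS]eq_bigr do rewrite mulr_sumr.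
rewrite exchange_big /=; apply: eq_bigr => w _.
under [RHS]eq_bigr do rewrite mulrA -big_split /=.
rewrite -mulr_suml; congr (_ * _).
rewrite -(bigA_distr_bigA
  (fun i (k : 'I_Q) => (f i)`_k * (p (w i) * d (w i) ^+ k))) /=.
apply: eq_bigr => i _; rewrite (horner_coef_wide _ (f_small i)) mulr_sumr.
by apply: eq_bigr => k _; rewrite mulrCA.
Qed.

(** The product of the [node_poly d (w i)] kills all label vectors but [w] on one side and its image
    under [s] on the other; the same nonzero factor [c] remains on both. *)
Lemma joint_moments_identify m d d' p p' (B B' : {ffun 'I_m -> 'I_Q} -> R)
    (s : {perm 'I_Q}) : injective d -> (forall q, p q != 0) ->
  (forall q, d' (s q) = d q /\ p' (s q) = p q) ->
  (forall k : {ffun 'I_m -> 'I_Q},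
     \sum_(w : {ffun 'I_m -> 'I_Q}) (\prod_i (p' (w i) * d' (w i) ^+ k i)) * B' w =
     \sum_(w : {ffun 'I_m -> 'I_Q}) (\prod_i (p (w i) * d (w i) ^+ k i)) * B w) ->
  forall w : {ffun 'I_m -> 'I_Q}, B' [ffun i => s (w i)] = B w.
Proof.
move=> d_inj p0 sE moments w.
pose f i := node_poly d (w i).
have f_small i : (size (f i) <= Q)%N by rewrite size_node_poly.
pose c := \prod_i (p (w i) * (f i).[d (w i)]).
have c0 : c != 0.
  by apply/prodf_neq0 => i _; rewrite mulf_neq0 // node_poly_neq0.
have others (v : {ffun 'I_m -> 'I_Q}) :
    v != w -> \prod_i (p (v i) * (f i).[d (v i)]) = 0.
  move=> vw; have [/forallP vwE|/forallPn[i vwi]] := boolP [forall i, v i == w i].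
    by case/eqP: vw; apply/ffunP => i; exact/eqP.
  by rewrite (bigD1 i) //= node_poly_root // mulr0 mul0r.
pose sh (v : {ffun 'I_m -> 'I_Q}) := [ffun i => s (v i)].
have sh_inj : injective sh.
  move=> u v /ffunP eq_uv; apply/ffunP => i.
  by have := eq_uv i; rewrite !ffunE => /perm_inj.
have shE v : \prod_i (p' (sh v i) * (f i).[d' (sh v i)]) =
    \prod_i (p (v i) * (f i).[d (v i)]).
  by apply: eq_bigr => i _; rewrite ffunE; have [-> ->] := sE (v i).
apply: (mulfI c0); have := joint_moments_poly d p B f_small.
under [X in _ = X]eq_bigr do rewrite -moments.
rewrite -joint_moments_poly // (bigD1 w) //= -/c big1 ?addr0 => [->|v vw]; last first.
  by rewrite others // mul0r.
rewrite (reindex_inj sh_inj) /= (bigD1 w) //= shE -/c big1 ?addr0 // => v vw.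
by rewrite shE others // mul0r.
Qed.

End VandermondeIdentification.

(** * Room for [M * Q] nodes *)

Lemma expn_leq_fact_sqr m : (m ^ m <= m`! ^ 2)%N.
Proof.
(* Two copies of the factorial are paired in opposite order; [(i + 1) (m - i) = (m - i) + i (m - i)]
   is at least [m]. *)
have -> : (m`! ^ 2 = \prod_(i < m) (i.+1 * (m - i)))%N.
  rewrite big_split /= expnS expn1 fact_prod big_add1 big_mkord; congr (_ * _)%N.
  rewrite (reindex_inj rev_ord_inj) /=.
  by apply: eq_bigr => i _; rewrite subnSK ?subKn.
rewrite -[X in (_ ^ X)%N](card_ord m) -prod_nat_const; apply: leq_prod => i _.
have i_lt := ltn_ord i; rewrite -{1}(subnKC (ltnW i_lt)) mulSn addnC leq_add2l.
by rewrite leq_pmulr // subn_gt0.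
Qed.

(** With [X = M! Q M + M - 1], the chain [M ^ (M - 1) <= M! ^ 2 <= X ^ 2] gives
    [M <= X ^ (2 / (M - 1))], hence [M Q <= Q ^ 2 M <= n]. *)
Lemma node_count_bound (R : realType) (M Q n : nat) (hM : (2 <= M)%N)
    (hQ : (1 <= Q)%N)
    (hn : Q%:R ^+ 2 *
            ((M`! * Q * M)%N%:R + M%:R - 1) `^ (2 / (M%:R - 1)) <= n%:R :> R) :
  (M * Q <= n)%N.
Proof.
have M0 : (0 < M)%N by exact: ltnW.
rewrite -(ler_nat R); apply: le_trans hn.
have M1 : 0 < (M%:R - 1 : R) by rewrite subr_gt0 ltr1n.
have factM : (M`!%:R : R) <= (M`! * Q * M)%N%:R + M%:R - 1.
  apply: (@le_trans _ _ (M`! * Q * M)%N%:R); last by rewrite -addrA lerDl ltW.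
  by rewrite ler_nat -mulnA leq_pmulr // muln_gt0 hQ.
apply: (@le_trans _ _ (Q%:R ^+ 2 * M%:R)).
  by rewrite natrM mulrC ler_pM2r ?ltr0n // expr2 ler_peMl ?ler0n ?ler1n.
rewrite ler_wpM2l ?exprn_ge0 ?ler0n //.
rewrite [leLHS](_ : _ = (M%:R `^ (M%:R - 1)) `^ (M%:R - 1)^-1); last first.
  by rewrite -powRrM mulfV ?gt_eqF // powRr1 // ler0n.
rewrite [leRHS]powRrM ge0_ler_powR ?nnegrE ?powR_ge0 ?invr_ge0 ?(ltW M1) //.
rewrite (powR_mulrn 2) ?(le_trans _ factM) ?ler0n //.
apply: (@le_trans _ _ (M`!%:R ^+ 2));
  last by rewrite lerXn2r ?nnegrE ?(le_trans _ factM) ?ler0n.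
rewrite -(natrB _ M0) powR_mulrn ?ler0n // -!natrX ler_nat.
by rewrite (leq_trans _ (expn_leq_fact_sqr M)) // leq_pexp2l // leq_subr.
Qed.

(** * Subhypergraph probabilities *)

Section HypergraphMoments.
Variables (R : realType) (Q M n : nat).
Implicit Types (theta : param R Q M) (z : {ffun 'I_n -> 'I_Q}).

(** Allows two sizes that differ as terms: a hyperedge carries [#|e|], a tuple its own [m]. *)
Lemma tensor_perm_eq theta m m' (hm : (1 < m <= M)%N) (hm' : (1 < m' <= M)%N)
    (q : m.-tuple 'I_Q) (q' : m'.-tuple 'I_Q) :
  perm_eq q q' -> tensor theta hm q = tensor theta hm' q'.
Proof.
move=> qq'; congr (theta (inr _)); apply/val_inj/val_inj => /=.
by apply/perm_sortP => //;
  [move=> x y; exact: leq_total | move=> x y z; exact: leq_trans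
  | move=> x y /anti_leq/val_inj].
Qed.

(** Given the labels the indicators are independent, and each hyperedge outside [E] sums out to
    1. *)
Lemma hyperedges_present theta (E : {set hyperedge M n}) :
  \sum_(y : hypergraph M n | [forall e in E, y e]) hsbm_law theta y =
  \sum_(z : {ffun 'I_n -> 'I_Q}) (\prod_v prior theta (z v)) *
    \prod_(e in E) hyperedge_prob theta z e.
Proof.
rewrite exchange_big /=; apply: eq_bigr => z _; rewrite -mulr_sumr.
congr (_ * _); rewrite big_mkcond /=.
(* The indicator of the event is absorbed into the factors, so that the sum over [y] distributes
   over the hyperedges. *)
pose f e b : R := bernoulli_pmf (hyperedge_prob theta z e) b *
  ((e \in E) ==> b)%:R.
transitivity (\sum_(y : hypergraph M n) \prod_e f e (y e)).
  apply: eq_bigr => y _; rewrite big_split /=.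
  case: ifP => [/forallP yE|/forallPn[e]].
    by rewrite [X in _ = _ * X]big1 ?mulr1 // => e _; rewrite yE.
  by move=> /negbTE ye; rewrite [X in _ = _ * X](bigD1 e) //= ye mul0r mulr0.
rewrite -bigA_distr_bigA [RHS]big_mkcond /=; apply: eq_bigr => e _.
rewrite big_bool /f /bernoulli_pmf /=.
by case: (e \in E); rewrite !(mulr1, mulr0, addr0) // addrC subrK.
Qed.

Lemma same_law_moments theta theta' (E : {set hyperedge M n}) :
  hsbm_law (n := n) theta' =1 hsbm_law (n := n) theta ->
  \sum_(z : {ffun 'I_n -> 'I_Q}) (\prod_v prior theta' (z v)) *
    \prod_(e in E) hyperedge_prob theta' z e =
  \sum_(z : {ffun 'I_n -> 'I_Q}) (\prod_v prior theta (z v)) *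
    \prod_(e in E) hyperedge_prob theta z e.
Proof.
by move=> same_law; rewrite -!hyperedges_present; apply: eq_bigr => y _.
Qed.

Lemma hyperedge_of_tuple m (hm : (1 < m <= M)%N) (s : m.-tuple 'I_n) :
  uniq s -> exists e : hyperedge M n, val e = [set v in s] /\
    forall theta z, hyperedge_prob theta z e = tensor theta hm (map_tuple z s).
Proof.
move=> s_uniq; have card_s : (1 < #|[set v in s]| <= M)%N.
  by rewrite cardsE (card_uniqP s_uniq) size_tuple.
exists (Sub [set v in s] card_s); split=> // theta z.
apply: tensor_perm_eq; apply: perm_map; apply: uniq_perm => //.
  exact: enum_uniq.
by move=> v; rewrite mem_enum inE.
Qed.

End HypergraphMoments.

(** * Pendant leaves *)

Lemma prod_over_image (R : comNzRingType) (X V : finType) (phi : X -> V)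
    (G : X -> V -> R) : injective phi ->
  \prod_v (if [pick x | phi x == v] is Some x then G x v else 1) =
  \prod_x G x (phi x).
Proof.
move=> phi_inj; rewrite (bigID (mem (phi @: [set: X]))) /=.
rewrite [X in _ * X]big1 => [|v v_phi]; last first.
  case: pickP => // x /eqP xv; case/imsetP: v_phi.
  by exists x; rewrite ?xv ?inE.
rewrite mulr1 big_imset /=; last by move=> x y _ _; exact: phi_inj.
under eq_bigl do rewrite inE; apply: eq_bigr => x _.
by case: pickP => [y /eqP/phi_inj -> //|/(_ x)]; rewrite eqxx.
Qed.

(* Summing out the labels of the pendant leaves [phi (i, l)], [0 < l <= k i],
   attaches the factor [d (w i) ^ k i] to the core vertex [phi (i, 0)]. *)
Lemma sum_over_leaves (R : comNzRingType) (Q m K : nat) (V : finType)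
    (phi : 'I_m * 'I_K.+1 -> V) (p : 'I_Q -> R) (b : 'I_Q -> 'I_Q -> R)
    (k : 'I_m -> nat) (H : {ffun 'I_m -> 'I_Q} -> R) :
  injective phi -> (forall i, k i <= K)%N -> \sum_q p q = 1 ->
  \sum_(z : {ffun V -> 'I_Q}) (\prod_v p (z v)) *
    ((\prod_(x : 'I_m * 'I_K.+1 | (0 < x.2 <= k x.1)%N)
        b (z (phi (x.1, ord0))) (z (phi x))) *
     H [ffun i => z (phi (i, ord0))]) =
  \sum_(w : {ffun 'I_m -> 'I_Q})
    (\prod_i (p (w i) * (\sum_r p r * b (w i) r) ^+ k i)) * H w.
Proof.
move=> phi_inj k_le sum1.
(* The core labels [w] become a separate summation variable tied to [z] by an indicator; for fixed
   [w] the rest factors over the vertices. *)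
pose F z (w : {ffun 'I_m -> 'I_Q}) : R := (\prod_v p (z v)) *
  ((\prod_(x : 'I_m * 'I_K.+1 | (0 < x.2 <= k x.1)%N)
      b (w x.1) (z (phi x))) * H w).
transitivity (\sum_(z : {ffun V -> 'I_Q}) \sum_w
    F z w * (w == [ffun i => z (phi (i, ord0))])%:R).
  apply: eq_bigr => z _.
  rewrite [RHS](bigD1 [ffun i => z (phi (i, ord0))]) //= eqxx mulr1.
  rewrite [X in _ + X]big1 => [|w /negbTE ->]; last by rewrite mulr0.
  by rewrite addr0; congr (_ * (_ * _)); apply: eq_bigr => x _; rewrite ffunE.
rewrite exchange_big /=; apply: eq_bigr => w _.
(* Edge factor at a leaf, indicator at a core point, 1 at the grid points beyond [k i]. *)
pose g (x : 'I_m * 'I_K.+1) q : R :=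
  (if (0 < x.2 <= k x.1)%N then b (w x.1) q else 1) *
  (if x.2 == ord0 then (w x.1 == q)%:R else 1).
pose h v q : R := p q * if [pick x | phi x == v] is Some x then g x q else 1.
have prod_g z : \prod_x g x (z (phi x)) =
    \prod_(x : 'I_m * 'I_K.+1 | (0 < x.2 <= k x.1)%N) b (w x.1) (z (phi x)) *
    (w == [ffun i => z (phi (i, ord0))])%:R.
  rewrite big_split /= -big_mkcond; congr (_ * _).
  have [->|/eqP neq_w] := eqVneq.
    rewrite big1 // => x _; rewrite ffunE; case: x => i l /=.
    by case: eqP => // ->; rewrite eqxx.
  have /existsP[i wi] : [exists i, w i != z (phi (i, ord0))].
    apply: contraT => /existsPn eq_w; case: neq_w; apply/ffunP => i; rewrite ffunE.
    by apply/eqP; have := eq_w i; rewrite negbK.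
  by rewrite (bigD1 (i, ord0)) //= (negbTE wi) mul0r.
transitivity (\sum_(z : {ffun V -> 'I_Q}) (\prod_v h v (z v)) * H w).
  apply: eq_bigr => z _; rewrite big_split /=.
  rewrite (prod_over_image (fun x v => g x (z v)) phi_inj) prod_g /F.
  by rewrite -!mulrA; do 2!congr (_ * _); rewrite mulrC.
rewrite -mulr_suml; congr (_ * _).
rewrite -(bigA_distr_bigA h) /=.
(* A vertex off the grid contributes the total mass 1 of [p]. *)
transitivity (\prod_v (if [pick x | phi x == v] is Some x
    then \sum_q p q * g x q else 1)).
  apply: eq_bigr => v _; rewrite /h; case: pickP => // _.
  by under eq_bigr do rewrite mulr1.
rewrite (prod_over_image (fun x _ => \sum_q p q * g x q) phi_inj).
rewrite -(pair_bigA _ (fun i l => \sum_q p q * g (i, l) q)) /=.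
apply: eq_bigr => i _; rewrite big_ord_recl; congr (_ * _).
  rewrite (bigD1 (w i)) //= /g /= eqxx !mulr1 big1 ?addr0 // => q qw.
  by rewrite eq_sym (negbTE qw) !mulr0.
transitivity (\prod_(l < K) if (l < k i)%N then \sum_r p r * b (w i) r else 1).
  apply: eq_bigr => l _; rewrite /g /= /bump /= add1n.
  by case: ifP => _; under eq_bigr do rewrite !mulr1.
by rewrite -big_mkcond (big_ord_narrow (k_le i)) prodr_const card_ord.
Qed.

Lemma grid_injection m K n : (m * K.+1 <= n)%N ->
  exists phi : 'I_m * 'I_K.+1 -> 'I_n, injective phi.
Proof.
move=> mK_n; have card_le : (#|{: 'I_m * 'I_K.+1}| <= n)%N.
  by rewrite card_prod !card_ord.
exists (fun x => widen_ord card_le (enum_rank x)) => x y /(congr1 val) /= eq_xy.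
exact/enum_rank_inj/val_inj.
Qed.

Section PendantMoments.
Variables (R : realType) (Q M n m K : nat) (hM : (1 < 2 <= M)%N).
Variables (phi : 'I_m * 'I_K.+1 -> 'I_n) (k : 'I_m -> nat).
Hypotheses (phi_inj : injective phi) (k_le : forall i, (k i <= K)%N).

(** [E] adds to [E0] the pendant edges at the core nodes. It is chosen before [theta], so that one
    event is compared under two parameters. *)
Lemma pendant_moments (e0 : hyperedge M n) (E0 : {set hyperedge M n}) :
  (forall e, e \in E0 -> val e \subset [set phi (i, ord0) | i : 'I_m]) ->
  exists E : {set hyperedge M n},
    forall (theta : param R Q M) (H : {ffun 'I_m -> 'I_Q} -> R),
      \sum_q prior theta q = 1 ->
      (forall z : {ffun 'I_n -> 'I_Q}, \prod_(e in E0) hyperedge_prob theta z e =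
         H [ffun i => z (phi (i, ord0))]) ->
      \sum_(z : {ffun 'I_n -> 'I_Q}) (\prod_v prior theta (z v)) *
        \prod_(e in E) hyperedge_prob theta z e =
      \sum_(w : {ffun 'I_m -> 'I_Q})
        (\prod_i (prior theta (w i) * mean_degree hM theta (w i) ^+ k i)) * H w.
Proof.
move=> E0_core.
have /fin_all_exists[edge edgeP] (x : 'I_m * 'I_K.+1) : exists e : hyperedge M n,
    (0 < x.2)%N -> val e = [set phi (x.1, ord0); phi x] /\
      forall (theta : param R Q M) z, hyperedge_prob theta z e =
        tensor theta hM [tuple z (phi (x.1, ord0)); z (phi x)].
  (* [e0] is a mere default at the core points. *)
  case: posnP => [_|x0]; first by exists e0.
  have pair_uniq : uniq [tuple phi (x.1, ord0); phi x].
    rewrite /= inE (inj_eq phi_inj) andbT; apply/eqP => /(congr1 (val \o snd)) /= x2.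
    by rewrite -x2 in x0.
  have [e [eE probE]] := hyperedge_of_tuple R Q hM pair_uniq.
  exists e => _; split=> [|theta z].
    by rewrite eE; apply/setP => v; rewrite !inE.
  by rewrite probE; apply: tensor_perm_eq.
pose leaves := [set x : 'I_m * 'I_K.+1 | (0 < x.2 <= k x.1)%N].
have leaf_edge x : x \in leaves -> val (edge x) = [set phi (x.1, ord0); phi x].
  by rewrite inE => /andP[/edgeP[]].
(* A leaf is never a core node, so it determines its pendant edge and keeps that edge out of
   [E0]. *)
have leaf_not_core x i : x \in leaves -> phi x != phi (i, ord0).
  by rewrite inE (inj_eq phi_inj) => /andP[x0 _]; apply: contraTneq x0 => ->.
have edge_inj : {in leaves &, injective edge}.
  move=> x y xL yL eq_xy; have: phi x \in val (edge x).
    by rewrite leaf_edge // !inE eqxx orbT.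
  rewrite eq_xy leaf_edge // !inE (negbTE (leaf_not_core _ _ xL)) /=.
  by move=> /eqP/phi_inj.
have E0_disj : [disjoint E0 & edge @: leaves].
  rewrite disjoint_sym; apply/pred0P => e /=; apply/negbTE/negP.
  move=> /andP[/imsetP[x xL ->] /E0_core /fintype.subsetP/(_ (phi x))].
  rewrite leaf_edge // !inE eqxx orbT => /(_ isT)/imsetP[i _ /eqP].
  by rewrite (negbTE (leaf_not_core _ _ xL)).
exists (E0 :|: edge @: leaves)%SET => theta H sum1 HE.
rewrite -(sum_over_leaves (fun q r => tensor theta hM [tuple q; r]) _
  phi_inj k_le sum1).
apply: eq_bigr => z _; congr (_ * _).
rewrite (eq_bigl [predU E0 & edge @: leaves]) => [|e]; last by rewrite !inE.
rewrite bigU //= HE mulrC; congr (_ * _); rewrite big_imset //=.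
apply: eq_big => [x|x xL]; first by rewrite inE.
by rewrite (edgeP x _).2 //; move: xL; rewrite inE => /andP[].
Qed.

End PendantMoments.

(** * Identification of the parameter from the law *)

Section Identification.
Variables (R : realType) (Q M n : nat) (hM : (1 < 2 <= M)%N).
Variables theta theta' : param R Q M.
Hypotheses (large_n : (M * Q <= n)%N) (Q0 : (0 < Q)%N).
Hypotheses (sum1 : \sum_q prior theta q = 1) (sum1' : \sum_q prior theta' q = 1).
Hypothesis same_law : hsbm_law (n := n) theta' =1 hsbm_law (n := n) theta.

Lemma some_hyperedge : exists e : hyperedge M n, True.
Proof.
have n2 : (1 < n)%N.
  by rewrite (leq_trans _ large_n) // (leq_trans (proj2 (andP hM))) // leq_pmulr.
have pair_uniq : uniq [tuple Ordinal (ltnW n2); Ordinal n2] by [].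
by have [e _] := hyperedge_of_tuple R Q hM pair_uniq; exists e.
Qed.

(** The event is a star: one core node with [k] leaves. The grid takes [2 Q] nodes, available since
    [M >= 2]. *)
Lemma star_moments k : (k < Q + Q)%N ->
  \sum_q prior theta' q * mean_degree hM theta' q ^+ k =
  \sum_q prior theta q * mean_degree hM theta q ^+ k.
Proof.
move=> k_lt; have [e0 _] := some_hyperedge.
have [|phi phi_inj] := @grid_injection 1 (Q + Q).-1 n.
  rewrite mul1n prednK ?addn_gt0 ?Q0 // (leq_trans _ large_n) // addnn -mul2n.
  by rewrite leq_mul2r (proj2 (andP hM)) orbT.
have k_le (i : 'I_1) : (k <= (Q + Q).-1)%N by rewrite -ltnS prednK // addn_gt0 Q0.
have [e|E momentE] := pendant_moments (k := fun=> k) R Q hM phi_inj k_le e0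
  (E0 := finset.set0); first by rewrite inE.
have := same_law_moments E same_law.
rewrite !(momentE _ (fun=> 1)) //; try by move=> z; rewrite finset.big_set0.
under eq_bigr do rewrite mulr1; under [RHS]eq_bigr do rewrite mulr1.
rewrite -!(bigA_distr_bigA (fun _ q => prior _ q * mean_degree hM _ q ^+ k)).
by rewrite !big_ord1.
Qed.

(** The event is a hyperedge on [m] core nodes, each with at most [Q - 1] leaves, hence a grid of
    [m Q] nodes. *)
Lemma core_moments m (hm : (1 < m <= M)%N) (k : {ffun 'I_m -> 'I_Q}) :
  \sum_(w : {ffun 'I_m -> 'I_Q})
    (\prod_i (prior theta' (w i) * mean_degree hM theta' (w i) ^+ k i)) *
    tensor theta' hm [tuple w i | i < m] =
  \sum_(w : {ffun 'I_m -> 'I_Q})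
    (\prod_i (prior theta (w i) * mean_degree hM theta (w i) ^+ k i)) *
    tensor theta hm [tuple w i | i < m].
Proof.
have [|phi phi_inj] := @grid_injection m Q.-1 n.
  by rewrite prednK // (leq_trans _ large_n) // leq_mul2r (proj2 (andP hm)) orbT.
have k_le i : (k i <= Q.-1)%N by rewrite -ltnS prednK.
have core_uniq : uniq [tuple phi (i, ord0) | i < m].
  by rewrite map_inj_uniq ?enum_uniq // => i j /phi_inj[].
have [e0 [e0E probE]] := hyperedge_of_tuple R Q hm core_uniq.
have core_edge (e : hyperedge M n) : e \in [set e0] ->
    val e \subset [set phi (i, ord0) | i : 'I_m].
  rewrite inE => /eqP ->; rewrite e0E; apply/fintype.subsetP => v; rewrite inE.
  by move=> /mapP[i _ ->]; apply: imset_f.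
have [E momentE] := pendant_moments (k := fun i => k i) R Q hM
  phi_inj k_le e0 core_edge.
have probH (t : param R Q M) z : \prod_(e in [set e0]) hyperedge_prob t z e =
    tensor t hm [tuple [ffun i => z (phi (i, ord0))] i | i < m].
  rewrite big_set1 probE; congr (tensor _ _ _); apply: eq_from_tnth => i.
  by rewrite !tnth_map tnth_ord_tuple ffunE.
pose H t (w : {ffun 'I_m -> 'I_Q}) := @tensor R Q M t m hm [tuple w i | i < m].
rewrite -(momentE theta' (H theta') sum1' (probH theta')).
rewrite -(momentE theta (H theta) sum1 (probH theta)).
exact: same_law_moments.
Qed.

Lemma identification : (forall q, prior theta q != 0) ->
  injective (mean_degree hM theta) ->
  exists s : {perm 'I_Q}, label_switching s theta theta'.
Proof.
move=> p0 d_inj; have [s sE] := moments_identify d_inj p0 star_moments.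
(* [s] sends labels of [theta] to labels of [theta'], while [label_switching] goes from [theta'] to
   [theta]. *)
exists (s^-1)%g; split=> [q|m hm q].
  by have [_ <-] := sE ((s^-1)%g q); rewrite permKV.
have := joint_moments_identify d_inj p0 sE (core_moments hm).
move=> /(_ [ffun i => (s^-1)%g (tnth q i)]) eqB.
transitivity (tensor theta' hm
  [tuple [ffun i => s ([ffun i => (s^-1)%g (tnth q i)] i)] i | i < m]).
  congr (tensor _ _ _); apply: eq_from_tnth => i.
  by rewrite tnth_map tnth_ord_tuple !ffunE permKV.
rewrite eqB; congr (tensor _ _ _); apply: eq_from_tnth => i.
by rewrite !tnth_map tnth_ord_tuple ffunE.
Qed.

End Identification.

Local Open Scope classical_set_scope.
Local Open Scope ring_scope.

Theorem corollary3 (R : realType) (M Q n : nat) (hM : (2 <= M)%N)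
    (hQ : (1 <= Q)%N)
    (hn : Q%:R ^+ 2 *
            ((M`! * Q * M)%N%:R + M%:R - 1) `^ (2 / (M%:R - 1)) <= n%:R :> R) :
  exists N : set (param R Q M),
    [/\ N `<=` @Theta R Q M,
        (zariski_dim N < zariski_dim (@Theta R Q M))%N &
        forall theta theta' : param R Q M,
          (@Theta R Q M `\` N) theta -> @Theta R Q M theta' ->
          hsbm_law (n := n) theta' =1 hsbm_law (n := n) theta ->
          exists s : {perm 'I_Q}, label_switching s theta theta'].
Proof.
have h2 : (1 < 2 <= M)%N by [].
exists (degenerate h2);
  split=> [theta []//||theta theta' [Ttheta ndeg] Ttheta' same_law].
  exact: degenerate_dim_lt (Ordinal hQ).
have sum1 (t : param R Q M) : Theta t -> \sum_q prior t q = 1 by case.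
have disc0 : discriminant h2 theta != 0 by apply/eqP => disc0; exact: ndeg.
move: disc0; rewrite mulf_eq0 negb_or => /andP[/prodf_neq0 p0 /prodf_neq0 d_neq].
have large_n := node_count_bound hM hQ hn.
apply: (identification large_n hQ (sum1 _ Ttheta) (sum1 _ Ttheta') same_law
  (hM := h2)) => [q|]; first exact: p0.
move=> q r eq_d; apply/eqP; apply: contraT => qr.
have /prodf_neq0/(_ r) := d_neq q isT; rewrite eq_sym qr eq_d subrr eqxx.
by move=> /(_ isT).
Qed.
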